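(* Let $0<\mu<1$. Then the countable product measures on $\mathbb{R}^{\mathbb{N}}$ are mutually singular: $$\nu_\mu^{\otimes\mathbb{N}}\perp\gamma^{\otimes\mathbb{N}} .$$ Moreover, the sequence (in $m\in\mathbb{N}$) $$\prod_{j=1}^m e_0^{(\mu)}(X_j)$$ does not converge in $L^2(\gamma^{\otimes\mathbb{N}})$, where $X_j$ is the $j$th coordinate map on $\mathbb{R}^{\mathbb{N}}$.
   Context: $\gamma(\mathrm{d}x)=(2\pi)^{-1/2}e^{-x^2/2}\,\mathrm{d}x$ on $\mathbb{R}$; $W^{1,2}(\gamma)$ is the space of locally absolutely continuous $f$ with $f,f'\in L^2(\gamma)$. $\mathbb{R}^{\mathbb{N}}$ carries its product Borel $\sigma$-algebra. For $0<\mu\le1$ let $c_\mu=\frac{1-\mu^2}{4\mu^2}$ and let $A_\mu$ be the nonnegative self-adjoint operator in $L^2(\gamma)$ associated with the closed form $$a_\mu[f,g]=\int_{-\infty}^\infty f'\overline{g'}\,\mathrm{d}\gamma+c_\mu\int_{-\infty}^0x^2f\overline g\,\mathrm{d}\gamma,\qquad \mathrm{Dom}(a_\mu)=W^{1,2}(\gamma);$$ it acts as $A_\mu f=-f''+xf'+c_\mu x^2\mathbf{1}_{\{x<0\}}f$. It has compact resolvent and simple eigenvalues $0\le\alpha_0(\mu)<\alpha_1(\mu)<\cdots$. $e_0^{(\mu)}$ is the strictly positive, continuously differentiable, $L^2(\gamma)$-normalised eigenfunction for the smallest eigenvalue $\alpha_0(\mu)$, and $\nu_\mu(\mathrm{d}x)=(e_0^{(\mu)}(x))^2\,\gamma(\mathrm{d}x)$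 is a probability measure on $\mathbb{R}$. *)

(* Defs.v *)
From mathcomp Require Import all_boot all_order all_algebra.
From mathcomp Require Import complex.
From mathcomp Require Import all_classical all_reals all_analysis.
Import Order.TTheory GRing.Theory Num.Theory.
Import numFieldNormedType.Exports.

Set Implicit Arguments.
Unset Strict Implicit.
Unset Printing Implicit Defensive.

Local Open Scope classical_set_scope.
Local Open Scope complex_scope.
Local Open Scope ring_scope.

(* Scalars are complex. Measurability, integrability, regularity and integrals of
   functions valued in R[i] are taken on real and imaginary parts. *)

Section ComplexL2.
Context d (T : measurableType d) (R : realType).
Variable P : {measure set T -> \bar R}.
Implicit Types f g : T -> R[i].

Definition inL2 f : Prop :=
  ((fun x => complex.Re (f x)) \in Lfun P 2%:E) /\
  ((fun x => complex.Im (f x)) \in Lfun P 2%:E).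

Definition Cintegral (D : set T) f : R[i] :=
  (\int[P]_(x in D) complex.Re (f x)) +i* (\int[P]_(x in D) complex.Im (f x)).

Definition L2inner f g : R[i] := Cintegral setT (fun x => f x * (g x)^*).

Definition L2norm f : \bar R :=
  'N[P]_(2%:E)[(fun x => (Normc.normc (f x))%:E)].

Definition L2cvg (u : nat -> T -> R[i]) f : Prop :=
  L2norm (fun x => u n x - f x) @[n --> \oo] --> 0%E.

End ComplexL2.

Definition mutually_singular d (T : measurableType d) (R : realType)
    (P Q : {measure set T -> \bar R}) : Prop :=
  exists A : set T, [/\ measurable A, P A = 0%E & Q (~` A) = 0%E].

Section SequenceSpace.
Variable R : realType.

Definition coordinate_sets : set (set (nat -> R)) :=
  [set A | exists (j : nat) (B : set R),
     measurable B /\ A = [set x | B (x j)]].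

(* R^N with its product Borel sigma-algebra. *)
Definition RN := g_sigma_algebraType coordinate_sets.

(* [P] is the countable power of [nu]: it has the product values on all
   finite-dimensional measurable rectangles. These form a pi-system generating
   the sigma-algebra of [RN], so [P] is determined by [nu]. *)
Definition is_countable_power (nu : set R -> \bar R) (P : probability RN R) :=
  forall (n : nat) (B : nat -> set R), (forall j, measurable (B j)) ->
    P [set x : RN | forall j, (j < n)%N -> B j (x j)] =
    (\prod_(j < n) nu (B j))%E.

End SequenceSpace.

Section GaussianForm.
Variable R : realType.
Implicit Types (mu lambda : R) (f g h : R -> R[i]).

Definition gauss : probability (measurableTypeR R) R := normal_prob 0 1.

Definition abs_continuous_on (a b : R) (f : R -> R) : Prop :=
  forall eps : R, 0 < eps -> exists2 delta : R, 0 < delta &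
    forall (n : nat) (u v : 'I_n -> R),
      (forall i, [/\ a <= u i, u i <= v i & v i <= b]) ->
      (forall i j, i != j -> v i <= u j \/ v j <= u i) ->
      \sum_(i < n) (v i - u i) < delta ->
      \sum_(i < n) `|f (v i) - f (u i)| < eps.

Definition locally_abs_continuous f : Prop :=
  forall a b : R, a <= b ->
    abs_continuous_on a b (fun x => complex.Re (f x)) /\
    abs_continuous_on a b (fun x => complex.Im (f x)).

(* For locally absolutely continuous [f] this is the almost everywhere
   derivative; [derive1] takes a default value where the limit fails to exist. *)
Definition Cderive f (x : R) : R[i] :=
  derive1 (fun y => complex.Re (f y)) x +i* derive1 (fun y => complex.Im (f y)) x.

Definition W12 f : Prop :=
  [/\ locally_abs_continuous f, inL2 gauss f & inL2 gauss (Cderive f)].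

Definition cmu mu : R := (1 - mu ^+ 2) / (4 * mu ^+ 2).

Definition energy_form mu f g : R[i] :=
  Cintegral gauss setT (fun x => Cderive f x * (Cderive g x)^*) +
  (cmu mu)%:C *
    Cintegral gauss `]-oo, 0] (fun x => (x ^+ 2)%:C * f x * (g x)^*).

(* The graph of the operator A_mu associated with the form: [f] lies in its
   domain and A_mu f = [g]. *)
Definition opA mu f g : Prop :=
  [/\ W12 f, inL2 gauss g &
      forall h, W12 h -> energy_form mu f h = L2inner gauss g h].

Definition is_eigenfunction mu lambda f : Prop :=
  ~ {ae gauss, forall x, f x = 0} /\ opA mu f (fun x => lambda%:C * f x).

Definition is_eigenvalue mu lambda : Prop := exists f, is_eigenfunction mu lambda f.

Definition is_smallest_eigenvalue mu lambda : Prop :=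
  is_eigenvalue mu lambda /\
  forall lambda', is_eigenvalue mu lambda' -> lambda <= lambda'.

Definition is_ground_state mu (e : R -> R) : Prop :=
  [/\ forall x, 0 < e x,
      (forall x, derivable e x 1) /\ continuous (derive1 e),
      ('N[gauss]_(2%:E)[EFin \o e] = 1)%E &
      exists alpha, is_smallest_eigenvalue mu alpha /\
                    is_eigenfunction mu alpha (fun x => (e x)%:C)].

Definition ground_measure (e : R -> R) : set R -> \bar R :=
  fun A => (\int[gauss]_(x in A) ((e x) ^+ 2)%:E)%E.

End GaussianForm.

(* Main.v *)
Require Import Defs.
From mathcomp Require Import all_boot all_order all_algebra.
From mathcomp Require Import complex.
From mathcomp Require Import all_classical all_reals all_analysis.
From mathcomp Require Import measurable_realfun.
From mathcomp Require Import ring lra.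
Import Order.TTheory GRing.Theory Num.Theory.
Import numFieldNormedType.Exports.
Local Open Scope classical_set_scope.
Local Open Scope complex_scope.
Local Open Scope ring_scope.

(** Write [g] for the Gaussian law, [e] for the ground state, and
    [Z_n x = \prod_(j < n) e (x j)]. Since [e ^ 2] is the density of the ground
    measure, [Z_n] is the square root of the likelihood ratio of the first [n]
    coordinates, and everything is governed by the Hellinger affinity
    [r = \int e dg]. The identity [\int (e - 1)^2 dg = 2 - 2 r] gives [r < 1]
    as soon as [e] differs somewhere from the constant [1], because [e] is
    continuous and [g] charges every interval.

    The constant [1] is not an eigenfunction ([one_not_eigenfunction]). If it
    were, the weak eigenvalue equation would read
    [c * \int_(x <= 0) x^2 h dg = alpha * \int h dg] for every [h] in W12. For
    the odd function [h x = x / (1 + x^2)^2] the right side vanishes by symmetry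
    of [g], while the left side is negative, as [c > 0] for [mu < 1].

    Products of functions of different coordinates integrate to the product of
    their integrals ([integral_coord_prod]). Hence [E_g Z_n = r ^ n], and, under
    the power of the ground measure, the expectation of [1 / Z_n] is also
    [r ^ n], since [e^-1 * e^2 = e]. By Markov's inequality [{1 <= Z_n}] has
    probability at most [r ^ n] under the Gaussian power, and its complement has
    probability at most [r ^ n] under the other one. These bounds are summable,
    so by Borel-Cantelli the limit superior of the events [{1 <= Z_n}]
    separates the two powers ([likelihood_singular]).

    Finally [E_g Z_n^2 = 1] and [E_g (Z_n * Z_(n+1)) = r], so consecutive terms
    stay at squared distance [2 - 2 r > 0]; the sequence is not Cauchy in L2
    ([likelihood_not_L2cvg]). *)

Set Implicit Arguments.
Unset Strict Implicit.
Unset Printing Implicit Defensive.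

(** * Integrals determined by indicators *)

Section weighted_integral.
Context d1 d2 (T : measurableType d1) (S : measurableType d2) (R : realType).
Variables (m : {measure set T -> \bar R}) (X : T -> S) (G : T -> R).
Hypotheses (mX : measurable_fun setT X) (mG : measurable_fun setT G).
Hypothesis G0 : forall x, 0 <= G x.

Let I (f : S -> R) : \bar R := (\int[m]_x (f (X x) * G x)%:E)%E.

Import HBNNSimple.

Lemma measurable_weighted (f : S -> R) : measurable_fun setT f ->
  measurable_fun setT (fun x => (f (X x) * G x)%:E).
Proof.
move=> mf; apply/measurable_EFinP; apply: measurable_funM => //.
exact: measurableT_comp.
Qed.

Lemma weighted_integral_simple (h : {nnsfun S >-> R}) :
  I h = (\sum_(r \in range h) (r%:E * I \1_(h @^-1` [set r])))%E.
Proof.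
rewrite /I.
(* The absolute value makes every summand nonnegative, also for [r] outside
   the range of [h], as termwise integration requires. *)
transitivity (\int[m]_x (\sum_(r \in range h)
    (`|r|%:E * (\1_(h @^-1` [set r]) (X x) * G x)%:E)))%E.
  apply: eq_integral => x _; rewrite [in LHS](fimfunE h) mulr_fsuml -fsumEFin//.
  apply: eq_fsbigr => r /set_mem[y _ <-].
  by rewrite ger0_norm// -EFinM mulrA.
rewrite ge0_integral_fsum//.
- apply: eq_fsbigr => r /set_mem[y _ <-].
  rewrite ger0_norm// ge0_integralZl//.
  + by apply: measurable_weighted; exact: measurable_indic.
  + by move=> x _; rewrite lee_fin mulr_ge0.
  + by rewrite lee_fin.
- move=> r; apply: measurable_funeM.
  by apply: measurable_weighted; exact: measurable_indic.
- by move=> r x _; rewrite mule_ge0// lee_fin mulr_ge0.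
Qed.

Lemma weighted_integral_limit (f : S -> R)
    (mf : measurable_fun setT (EFin \o f)) : (forall y, 0 <= f y) ->
  I f = limn (fun n => I (nnsfun_approx measurableT mf n)).
Proof.
move=> f0; rewrite /I -monotone_convergence//.
- apply: eq_integral => x _; apply/esym/cvg_lim => //.
  rewrite EFinM; under eq_fun do rewrite EFinM.
  apply: cvgeZr => //.
  by apply: (cvg_nnsfun_approx measurableT mf) => // y _; rewrite lee_fin.
- by move=> n; apply: measurable_weighted.
- by move=> n x _; rewrite lee_fin mulr_ge0.
- move=> x _ a b ab; rewrite lee_fin ler_wpM2r//.
  exact/lefP/nd_nnsfun_approx.
Qed.

End weighted_integral.

Section eq_weighted_integral.
Import HBNNSimple.

(** A weighted integral [f |-> \int f(X) G dm] is determined by its values on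
    indicators. It serves in place of a change of variables from the law of
    [X] under the density [G]. *)
Lemma eq_weighted_integral d1 d2 d3 (T1 : measurableType d1)
    (T2 : measurableType d2) (S : measurableType d3) (R : realType)
    (m1 : {measure set T1 -> \bar R}) (m2 : {measure set T2 -> \bar R})
    (X1 : T1 -> S) (X2 : T2 -> S) (G1 : T1 -> R) (G2 : T2 -> R) :
  measurable_fun setT X1 -> measurable_fun setT X2 ->
  measurable_fun setT G1 -> measurable_fun setT G2 ->
  (forall x, 0 <= G1 x) -> (forall x, 0 <= G2 x) ->
  (forall B : set S, measurable B ->
    \int[m1]_x (\1_B (X1 x) * G1 x)%:E = \int[m2]_x (\1_B (X2 x) * G2 x)%:E)%E ->
  forall f : S -> R, measurable_fun setT f -> (forall y, 0 <= f y) ->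
    (\int[m1]_x (f (X1 x) * G1 x)%:E = \int[m2]_x (f (X2 x) * G2 x)%:E)%E.
Proof.
move=> mX1 mX2 mG1 mG2 G10 G20 eqB f mf f0.
have mEf : measurable_fun setT (EFin \o f) by exact/measurable_EFinP.
rewrite (weighted_integral_limit m1 mX1 mG1 G10 mEf)//.
rewrite (weighted_integral_limit m2 mX2 mG2 G20 mEf)//.
apply: (@congr1 _ _ (fun u : (\bar R)^nat => limn u)); apply/funext => n.
rewrite weighted_integral_simple// [RHS]weighted_integral_simple//.
by apply: eq_fsbigr => r _; rewrite eqB//.
Qed.

End eq_weighted_integral.

(** * Integrals of products over coordinates *)

Section countable_power.
Context {R : realType}.

Lemma measurable_coord (j : nat) :
  measurable_fun setT (fun x : RN R => x j : R).
Proof.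
move=> _ B mB; rewrite setTI; apply: sub_sigma_algebra.
by exists j, B; split.
Qed.

Lemma measurable_rectangle (n : nat) (B : nat -> set R) :
  (forall j, measurable (B j)) ->
  measurable [set x : RN R | forall j, (j < n)%N -> B j (x j)].
Proof.
move=> mB; rewrite (_ : mkset _ =
    \big[setI/setT]_(j < n) [set x : RN R | B j (x j)]).
  apply: bigsetI_measurable => j _; rewrite -[mkset _]setTI.
  by apply: measurable_coord.
rewrite -(bigcap_mkord n (fun j => [set x : RN R | B j (x j)])).
by apply/seteqP; split => x /= xB j; [move/xB|exact: xB].
Qed.

Lemma measurable_coord_prod (n : nat) (P : pred 'I_n) (f : nat -> R -> R) :
  (forall j, measurable_fun setT (f j)) ->
  measurable_fun setT (fun x : RN R => \prod_(j < n | P j) f j (x j)).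
Proof.
move=> mf; rewrite [X in measurable_fun _ X](_ : _ = fun x : RN R =>
    \prod_(j < n) (if P j then f j (x j) else 1)); last first.
  by apply/funext => x; rewrite big_mkcond.
apply: measurable_prod => j _; case: (P j) => //.
exact: (measurableT_comp (mf j) (measurable_coord j)).
Qed.

Variables (m : probability (measurableTypeR R) R) (w : R -> R).
Hypotheses (mw : measurable_fun setT w) (w0 : forall y, 0 <= w y).
Variable P : probability (RN R) R.
Hypothesis Pw : is_countable_power (fun A => \int[m]_(y in A) (w y)%:E)%E P.

Lemma weighted_indic (B : set R) : measurable B ->
  (\int[m]_y (\1_B y * w y)%:E = \int[m]_(y in B) (w y)%:E)%E.
Proof.
move=> mB; rewrite [RHS]integral_mkcond; apply: eq_integral => y _.
by rewrite /patch indicE; case: ifPn => _; rewrite ?mul1r ?mul0r.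
Qed.

Lemma weighted_indic_lty (B : set R) : measurable B ->
  (\int[m]_y (\1_B y * w y)%:E < +oo)%E.
Proof.
move=> mB; rewrite weighted_indic//.
have := Pw 1%N (fun=> mB); rewrite big_ord1 => <-.
apply: (le_lt_trans (probability_le1 _ _)); last exact: ltry.
exact: measurable_rectangle (fun=> mB).
Qed.

(** The law [P] is only prescribed on rectangles, that is for indicators
    [f j]. Indicators are replaced by general functions one coordinate at a
    time: for fixed functions of the other coordinates, both sides are weighted
    integrals of [f k]. Finiteness of the factors lets the product of the
    others be absorbed into the weight as a real constant. *)
Lemma integral_coord_prod (f : nat -> R -> R) (n : nat) :
  (forall j, measurable_fun setT (f j)) -> (forall j y, 0 <= f j y) ->
  (forall j, \int[m]_y (f j y * w y)%:E < +oo)%E ->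
  (\int[P]_x (\prod_(j < n) f j (x j))%:E =
   \prod_(j < n) \int[m]_y (f j y * w y)%:E)%E.
Proof.
move=> mf f0 foo.
(* Induction on the number [k] of coordinates carrying a general function. *)
suff H k : (k <= n)%N -> forall g : nat -> R -> R,
    (forall j, measurable_fun setT (g j)) -> (forall j y, 0 <= g j y) ->
    (forall j, \int[m]_y (g j y * w y)%:E < +oo)%E ->
    (forall j, (k <= j)%N -> exists2 B, measurable B & g j = \1_B) ->
    (\int[P]_x (\prod_(j < n) g j (x j))%:E =
     \prod_(j < n) \int[m]_y (g j y * w y)%:E)%E.
  (* Coordinates from [n] on do not occur in the product. *)
  pose g j := if (j < n)%N then f j else cst 1.
  transitivity (\int[P]_x (\prod_(j < n) g j (x j))%:E)%E.
    apply: eq_integral => x _; congr EFin.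
    by apply: eq_bigr => j _; rewrite /g ltn_ord.
  rewrite (H n)//.
  - by apply: eq_bigr => j _; rewrite /g ltn_ord.
  - by move=> j; rewrite /g; case: ifP.
  - by move=> j y; rewrite /g; case: ifP => // _; exact: ler01.
  - move=> j; rewrite /g; case: ifP => // _.
    rewrite (_ : cst 1 = \1_[set: R]); first exact: weighted_indic_lty.
    by apply/funext => y; rewrite indicE in_setT.
  - move=> j nj; exists setT => //.
    by rewrite /g ltnNge nj/=; apply/funext => y; rewrite indicE in_setT.
elim: k => [_ g _ _ _ gB|k IH kn g mg g0 goo gB].
  have /choice[B BP] : forall j, exists B, measurable B /\ g j = \1_B.
    by move=> j; have [//|B mB ->] := gB j; exists B.
  transitivity (P [set x : RN R | forall j, (j < n)%N -> B j (x j)]).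
    set E := [set x : RN R | _].
    have mE : measurable E.
      by apply: measurable_rectangle => j; case: (BP j).
    rewrite -[in RHS](setIT E) -integral_indic//.
    apply: eq_integral => x _; congr EFin; rewrite indicE.
    have [xB|xB] := boolP (x \in _).
      rewrite big1// => j _; rewrite (BP j).2 indicE mem_set//.
      by move/set_mem : xB; apply.
    apply/eqP; apply: contraNT xB => /prodf_neq0 xB.
    apply/mem_set => j jn; have := xB (Ordinal jn) isT.
    rewrite (BP j).2 indicE; case: (boolP (_ \in _)) => [/set_mem//|_].
    by rewrite eqxx.
  rewrite Pw; last by move=> j; case: (BP j).
  by apply: eq_bigr => j _; rewrite (BP j).2 weighted_indic//; case: (BP j).
pose i := Ordinal kn.
have c0 : (0 <= \prod_(j < n | j != i) \int[m]_y (g j y * w y)%:E)%E.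
  apply: prode_ge0 => j _; apply: integral_ge0 => y _.
  by rewrite lee_fin mulr_ge0.
have cfin : (\prod_(j < n | j != i) \int[m]_y (g j y * w y)%:E \is a fin_num)%E.
  apply: prode_fin_num => j _; rewrite ge0_fin_numE// integral_ge0// => y _.
  by rewrite lee_fin mulr_ge0.
rewrite (bigD1 i)//=.
set c := (\prod_(j < n | j != i) _)%E in c0 cfin *.
have cE : c = (fine c)%:E by rewrite fineK.
transitivity (\int[P]_x (g k (x k) * (\prod_(j < n | j != i) g j (x j)))%:E)%E.
  by apply: eq_integral => x _; rewrite (bigD1 i).
transitivity (\int[m]_y (g k y * (fine c * w y))%:E)%E; last first.
  rewrite muleC cE -ge0_integralZl//.
  - by apply: eq_integral => y _; rewrite -EFinM mulrCA.
  - by apply/measurable_EFinP; apply: measurable_funM; [exact: mg|exact: mw].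
  - by move=> y _; rewrite lee_fin mulr_ge0.
  - by rewrite -cE.
apply: (@eq_weighted_integral _ _ _ (RN R) (measurableTypeR R)
    (measurableTypeR R) R P m (fun x => x k) id) => //.
- exact: measurable_coord.
- exact: measurable_coord_prod.
- by apply: measurable_funM.
- by move=> x; apply: prodr_ge0.
- by move=> x; rewrite mulr_ge0// fine_ge0.
move=> B mB.
pose g' j := if j == k then \1_B else g j.
have g'k : g' i = \1_B by rewrite /g' eqxx.
have g'E (j : 'I_n) : j != i -> g' j = g j.
  by move=> ji; rewrite /g' ifN.
transitivity (\int[P]_x (\prod_(j < n) g' j (x j))%:E)%E.
  apply: eq_integral => x _; rewrite [in RHS](bigD1 i)//= g'k; congr (_ * _)%:E.
  by apply: eq_bigr => j /g'E ->.
rewrite (IH (ltnW kn) g').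
- rewrite (bigD1 i)//= g'k.
  under eq_bigr => j /g'E -> do over.
  rewrite -/c muleC cE -ge0_integralZl//.
  - by apply: eq_integral => y _; rewrite -EFinM mulrCA.
  - apply/measurable_EFinP/measurable_funM => //; exact: measurable_indic.
  - by move=> y _; rewrite lee_fin mulr_ge0.
  - by rewrite -cE.
- by move=> j; rewrite /g'; case: ifP => // _; exact: measurable_indic.
- by move=> j y; rewrite /g'; case: ifP.
- move=> j; rewrite /g'; case: ifP => // _.
  exact: weighted_indic_lty.
- move=> j kj; rewrite /g'; case: eqP => [_|/eqP jk]; first by exists B.
  by apply: gB; rewrite ltn_neqAle eq_sym jk.
exact: mg.
Qed.

End countable_power.

(** * Norms of complex-valued functions *)

Lemma Lfun_measurable d (T : measurableType d) (R : realType)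
    (P : {measure set T -> \bar R}) p (f : T -> R) :
  f \in Lfun P p -> measurable_fun setT f.
Proof. by move=> /sub_Lfun_mfun; rewrite inE. Qed.

Lemma sqr_normc (R : rcfType) (z : R[i]) :
  Normc.normc z ^+ 2 = complex.Re z ^+ 2 + complex.Im z ^+ 2.
Proof. by case: z => a b /=; rewrite sqr_sqrtr// addr_ge0 ?sqr_ge0. Qed.

Lemma integral_normc_sqr d (T : measurableType d) (R : realType)
    (P : {measure set T -> \bar R}) (f : T -> R[i]) (eps : R) : 0 < eps ->
  (L2norm P f < eps%:E)%E ->
  (\int[P]_x ((Normc.normc (f x)) ^+ 2)%:E <= (eps ^+ 2)%:E)%E.
Proof.
move=> eps0 feps.
rewrite (_ : (\int[P]_x _)%E = L2norm P f `^ 2)%E; last first.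
  rewrite /L2norm poweR_Lnorm//; apply: eq_integral => x _.
  rewrite gee0_abs ?lee_fin//; last by case: (f x) => a b; exact: sqrtr_ge0.
  by rewrite poweR_EFin -powR_mulrn//; case: (f x) => a b; exact: sqrtr_ge0.
rewrite -(powR_mulrn _ (ltW eps0)) -poweR_EFin.
apply: (@gt0_ler_poweR _ 2 (ler0n _ _)); last exact: ltW.
- by rewrite in_itv/= leey andbT; exact: Lnorm_ge0.
- by rewrite in_itv/= leey andbT lee_fin ltW.
Qed.

(** * Singularity of the two powers *)

Lemma measurable_ge1 d (T : measurableType d) (R : realType) (Z : T -> R) :
  measurable_fun setT Z -> measurable [set x | 1 <= Z x].
Proof.
move=> mZ; rewrite (_ : mkset _ = Z @^-1` `[1, +oo[).
  by rewrite -[_ @^-1` _]setTI; exact: mZ.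
by apply/seteqP; split => x /=; rewrite in_itv/= andbT.
Qed.

Lemma measure_ge1_le_integral d (T : measurableType d) (R : realType)
    (P : {measure set T -> \bar R}) (Z : T -> R) :
  measurable_fun setT Z -> (forall x, 0 <= Z x) ->
  (P [set x | (1 <= Z x)%R] <= \int[P]_x (Z x)%:E)%E.
Proof.
move=> mZ Z0; set A := [set x | _].
have mA : measurable A by exact: measurable_ge1.
rewrite -[A in leLHS]setIT -integral_indic//; apply: ge0_le_integral => //.
- exact/measurable_EFinP/measurable_indic.
- exact/measurable_EFinP.
- move=> x _; rewrite lee_fin indicE.
  by case: (boolP (x \in A)) => [/set_mem//|_]; exact: Z0.
Qed.

Lemma lim_sup_set_geometric d (T : measurableType d) (R : realType)
    (P : {measure set T -> \bar R}) (F : nat -> set T) (r : R) :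
  (forall n, measurable (F n)) -> 0 <= r < 1 ->
  (forall n, P (F n) <= (r ^+ n)%:E)%E -> P (lim_sup_set F) = 0%E.
Proof.
move=> mF /andP[r0 r1] PF; apply: lim_sup_set_cvg0 => //.
apply: (@le_lt_trans _ _ (\sum_(0 <= n <oo) (r ^+ n)%:E)%E).
  by apply: lee_nneseries => // n _; exact: PF.
have cr : cvgn (series (geometric 1 r)).
  by apply: is_cvg_geometric_series; rewrite ger0_norm.
rewrite [X in limn X](_ : _ = EFin \o series (geometric 1 r)).
  by rewrite EFin_lim// ltry.
apply/funext => n /=; rewrite sumEFin; congr EFin.
by apply: eq_bigr => k _; rewrite /= mul1r.
Qed.

Section likelihood.
Context {R : realType}.
Variables (e : R -> R) (r : R) (nuN gammaN : probability (RN R) R).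
Hypotheses (ce : continuous e) (e0 : forall y, 0 < e y).
Hypothesis e1 : (\int[gauss R]_y (e y ^+ 2)%:E = 1)%E.
Hypothesis er : (\int[gauss R]_y (e y)%:E = r%:E)%E.
Hypothesis r1 : r < 1.
Hypothesis nuNP : is_countable_power (ground_measure e) nuN.
Hypothesis gammaNP : is_countable_power (gauss R) gammaN.

Let me : measurable_fun setT e.
Proof. exact: continuous_measurable_fun. Qed.

Let r01 : 0 <= r < 1.
Proof.
by rewrite r1 andbT -lee_fin -er integral_ge0// => y _; rewrite lee_fin ltW.
Qed.

Let prod_cst (a : R) n : (\prod_(j < n) a%:E = (a ^+ n)%:E)%E.
Proof. by rewrite prodEFin prodr_const card_ord. Qed.

Lemma integral_gauss_prod (f : nat -> R -> R) (n : nat) :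
  (forall j, measurable_fun setT (f j)) -> (forall j y, 0 <= f j y) ->
  (forall j, \int[gauss R]_y (f j y)%:E < +oo)%E ->
  (\int[gammaN]_x (\prod_(j < n) f j (x j))%:E =
   \prod_(j < n) \int[gauss R]_y (f j y)%:E)%E.
Proof.
move=> mf f0 foo.
rewrite (@integral_coord_prod _ (gauss R) (cst 1))//.
- by apply: eq_bigr => j _; apply: eq_integral => y _; rewrite mulr1.
- move=> m B mB; rewrite gammaNP//; apply: eq_bigr => j _.
  by have := integral_cst (gauss R) (mB j) 1; rewrite mul1e => <-.
- by move=> j; under eq_integral => y _ do rewrite mulr1.
Qed.

Let meas_prod (f : R -> R) n : measurable_fun setT f ->
  measurable_fun setT (fun x : RN R => \prod_(j < n) f (x j)).
Proof. by move=> mf; apply: (@measurable_coord_prod _ n xpredT (fun=> f)). Qed.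

Let meV : measurable_fun setT (fun y => (e y)^-1).
Proof.
apply: continuous_measurable_fun => y; apply: cvgV; first by rewrite gt_eqF.
exact: ce.
Qed.

(** Markov's inequality for [Z_n] under one power and for [1 / Z_n] under the
    other bounds by [r ^ n] the two probabilities of error of the test that
    compares [Z_n] with [1]. *)
Lemma likelihood_singular : mutually_singular nuN gammaN.
Proof.
pose A n := [set x : RN R | 1 <= \prod_(j < n) e (x j)].
have mA n : measurable (A n) by apply: measurable_ge1; exact: meas_prod.
have gA n : (gammaN (A n) <= (r ^+ n)%:E)%E.
  apply: (le_trans (measure_ge1_le_integral gammaN (meas_prod n me) _)).
    by move=> x; apply: prodr_ge0 => j _; exact: ltW.
  rewrite (@integral_gauss_prod (fun=> e))//.
  - by rewrite -prod_cst; under eq_bigr do rewrite er.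
  - by move=> _ y; exact: ltW.
  - by rewrite er ltry.
have nA n : (nuN (~` A n) <= (r ^+ n)%:E)%E.
  have sA : ~` A n `<=` [set x : RN R | 1 <= \prod_(j < n) (e (x j))^-1].
    move=> x /= /negP; rewrite -ltNge prodfV => /ltW Z1.
    by rewrite invf_ge1// prodr_gt0.
  have mV := meas_prod n meV.
  apply: (@le_trans _ _
    (nuN [set x : RN R | (1 <= \prod_(j < n) (e (x j))^-1)%R])).
    apply: le_measure => //; rewrite inE; first exact: measurableC.
    exact: measurable_ge1.
  apply: (le_trans (measure_ge1_le_integral nuN mV _)).
    by move=> x; apply: prodr_ge0 => j _; rewrite invr_ge0 ltW.
  have eV : (\int[gauss R]_y ((e y)^-1 * e y ^+ 2)%:E = r%:E)%E.
    rewrite -er; apply: eq_integral => y _.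
    by rewrite expr2 mulrA mulVf ?mul1r// gt_eqF.
  rewrite (@integral_coord_prod _ (gauss R) (fun y => e y ^+ 2) _ _ nuN nuNP
    (fun _ y => (e y)^-1))//.
  - by rewrite -prod_cst; under eq_bigr do rewrite eV.
  - exact: measurable_funX.
  - by move=> y; rewrite sqr_ge0.
  - by move=> _ y; rewrite invr_ge0 ltW.
  - by rewrite eV ltry.
have mlim F : (forall n, measurable (F n)) ->
    measurable (lim_sup_set F : set (RN R)).
  move=> mF; apply: bigcap_measurable => [|n _]; first by exists 0%N.
  exact: bigcup_measurable.
exists (~` lim_sup_set A); split.
- apply: measurableC; exact: mlim.
- apply/eqP; rewrite eq_le measure_ge0 andbT.
  rewrite -(lim_sup_set_geometric (fun n => measurableC (mA n)) r01 nA).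
  apply: le_measure; rewrite ?inE.
  + apply: measurableC; exact: mlim.
  + by apply: mlim => n; apply: measurableC; exact: mA.
  + move=> x; rewrite /lim_sup_set setC_bigcap => -[n _ nx] k _.
    exists (maxn n k) => /=; first exact: leq_maxr.
    by move=> xA; apply: nx; exists (maxn n k) => //=; exact: leq_maxl.
- by rewrite setCK; exact: (lim_sup_set_geometric mA r01 gA).
Qed.

(** * Failure of convergence in L2 *)

Lemma gauss_power_sqr n :
  (\int[gammaN]_x ((\prod_(j < n) e (x j)) ^+ 2)%:E = 1)%E.
Proof.
transitivity (\int[gammaN]_x (\prod_(j < n) e (x j) ^+ 2)%:E)%E.
  by apply: eq_integral => x _; rewrite -prodrXl.
rewrite (@integral_gauss_prod (fun _ y => e y ^+ 2)).
- by rewrite big1.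
- by move=> _; exact: measurable_funX.
- by move=> _ y; rewrite sqr_ge0.
- by move=> _; rewrite e1 ltry.
Qed.

(** [Z_n * Z_(n+1) = Z_n ^ 2 * e (x n)]: the first [n] coordinates contribute
    [\int e^2 dg = 1] each and the last one contributes [r]. *)
Lemma gauss_power_consecutive n :
  (\int[gammaN]_x
    ((\prod_(j < n) e (x j)) * (\prod_(j < n.+1) e (x j)))%:E = r%:E)%E.
Proof.
pose f (j : nat) y := if (j < n)%N then e y ^+ 2 else e y.
transitivity (\int[gammaN]_x (\prod_(j < n.+1) f j (x j))%:E)%E.
  apply: eq_integral => x _; congr EFin.
  rewrite !big_ord_recr/= {2}/f ltnn mulrA -expr2 -prodrXl; congr (_ * _).
  by apply: eq_bigr => j _; rewrite /f ltn_ord.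
rewrite integral_gauss_prod.
- rewrite big_ord_recr/= big1 ?mul1e => [|j _].
    by rewrite -er; apply: eq_integral => y _; rewrite /f ltnn.
  by rewrite -e1; apply: eq_integral => y _; rewrite /f ltn_ord.
- by move=> j; rewrite /f; case: (j < n)%N; [exact: measurable_funX|exact: me].
- by move=> j y; rewrite /f; case: (j < n)%N; [exact: sqr_ge0|exact: ltW].
- by move=> j; rewrite /f; case: (j < n)%N; rewrite ?e1 ?er ltry.
Qed.

Let Z n (x : RN R) : R := \prod_(j < n) e (x j).

Let mZ n : measurable_fun setT (Z n).
Proof. exact: meas_prod. Qed.

Let Z0 n x : 0 <= Z n x.
Proof. by apply: prodr_ge0 => j _; exact: ltW. Qed.

Lemma gauss_power_increment n :
  (\int[gammaN]_x ((Z n x - Z n.+1 x) ^+ 2)%:E = (2 - 2 * r)%:E)%E.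
Proof.
have H : (\int[gammaN]_x ((Z n x - Z n.+1 x) ^+ 2)%:E + 2%:E * r%:E = 2%:E)%E.
  rewrite -(gauss_power_consecutive n) -ge0_integralZl//.
  - rewrite -ge0_integralD//.
    + transitivity (\int[gammaN]_x ((Z n x ^+ 2)%:E + (Z n.+1 x ^+ 2)%:E))%E.
        apply: eq_integral => x _; rewrite -EFinM -!EFinD; congr EFin.
        by rewrite -/(Z n x) -/(Z n.+1 x); ring.
      rewrite ge0_integralD//.
      * by rewrite !gauss_power_sqr.
      * by move=> x _; rewrite lee_fin sqr_ge0.
      * by apply/measurable_EFinP; apply: measurable_funX.
      * by move=> x _; rewrite lee_fin sqr_ge0.
      * by apply/measurable_EFinP; apply: measurable_funX.
    + by move=> x _; rewrite lee_fin sqr_ge0.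
    + by apply/measurable_EFinP; apply: measurable_funX; apply: measurable_funB.
    + by move=> x _; rewrite mule_ge0// lee_fin mulr_ge0// Z0.
    + apply: measurable_funeM; apply/measurable_EFinP.
      by apply: measurable_funM; exact: mZ.
  - by apply/measurable_EFinP; apply: measurable_funM; exact: mZ.
  - by move=> x _; rewrite lee_fin mulr_ge0// Z0.
move: H; case: integral => [a| |]//; rewrite -EFinM -EFinD => -[aE].
by congr EFin; lra.
Qed.

(** Squared distances replace the triangle inequality:
    [(u - v)^2 <= 2 |u - F|^2 + 2 |v - F|^2]. *)
Lemma likelihood_not_L2cvg (F : RN R -> R[i]) : inL2 gammaN F ->
  ~ L2cvg gammaN (fun m x => (\prod_(j < m) e (x j))%:C) F.
Proof.
move=> [/Lfun_measurable mRe /Lfun_measurable mIm] ZF.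
(* Two consecutive terms within [eps] of [F] would be at squared distance at
   most [4 * eps ^+ 2 = (1 - r) ^+ 2 < 2 - 2 * r]. *)
pose eps : R := (1 - r) / 2.
have /andP[r0 _] := r01.
have eps0 : 0 < eps by rewrite divr_gt0// subr_gt0.
have mN n :
    measurable_fun setT (fun x => (Normc.normc ((Z n x)%:C - F x) ^+ 2)%:E).
  apply/measurable_EFinP; rewrite [X in measurable_fun _ X](_ : _ = fun x =>
      (Z n x - complex.Re (F x)) ^+ 2 + (complex.Im (F x)) ^+ 2).
    apply: measurable_funD; apply: measurable_funX => //.
    exact: measurable_funB.
  apply/funext => x; rewrite sqr_normc; case: (F x) => a b /=.
  by rewrite sub0r sqrrN.
have near : \forall n \near \oo,
    (L2norm gammaN (fun x => ((Z n x)%:C - F x)%R) < eps%:E)%E.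
  move/fine_cvgP : ZF => [Zfin /cvgr_lt /(_ eps eps0)] Zlt.
  near=> n; rewrite -[ltLHS]fineK ?lte_fin; last by near: n.
  by near: n.
have [N _ HN] := near.
have B n : (N <= n)%N ->
    (\int[gammaN]_x ((Normc.normc ((Z n x)%:C - F x)%R) ^+ 2)%:E
      <= (eps ^+ 2)%:E)%E.
  by move=> Nn; apply: integral_normc_sqr => //; apply: HN.
have : ((2 - 2 * r)%:E <= 2%:E * (eps ^+ 2)%:E + 2%:E * (eps ^+ 2)%:E)%E.
  apply: (@le_trans _ _ (\int[gammaN]_x
      (2%:E * (Normc.normc ((Z N x)%:C - F x)%R ^+ 2)%:E +
       2%:E * (Normc.normc ((Z N.+1 x)%:C - F x)%R ^+ 2)%:E))%E).
    rewrite -(gauss_power_increment N); apply: ge0_le_integral => //.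
    - by move=> x _; rewrite lee_fin sqr_ge0.
    - by apply/measurable_EFinP; apply: measurable_funX; apply: measurable_funB.
    - by apply: emeasurable_funD; apply: measurable_funeM.
    - move=> x _; rewrite -!EFinM -EFinD lee_fin !sqr_normc.
      case: (F x) => a b /=; move: (Z N x) (Z N.+1 x) => u v.
      (* The difference of the two sides is [(u + v - 2 a)^2 + 4 b^2]. *)
      have := sqr_ge0 (u + v - 2 * a); have := sqr_ge0 b; rewrite sub0r; nra.
  rewrite ge0_integralD//.
  - rewrite !ge0_integralZl//.
    + by apply: leeD; apply: lee_wpmul2l => //; exact: B.
    + by move=> x _; rewrite lee_fin sqr_ge0.
    + by move=> x _; rewrite lee_fin sqr_ge0.
  - by move=> x _; rewrite mule_ge0// lee_fin sqr_ge0.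
  - exact: measurable_funeM.
  - by move=> x _; rewrite mule_ge0// lee_fin sqr_ge0.
  - exact: measurable_funeM.
rewrite -!EFinM -EFinD lee_fin => le_eps.
have : 0 < (1 - r) * (1 + r) by rewrite mulr_gt0 ?subr_gt0// ltr_pwDl.
suff -> : (1 - r) * (1 + r) = 2 - 2 * r - (2 * eps ^+ 2 + 2 * eps ^+ 2).
  by rewrite subr_gt0 ltNge le_eps.
by rewrite /eps; field.
Unshelve. all: by end_near.
Qed.

End likelihood.

(** * The Gaussian measure and its Sobolev space *)

Lemma integral_gt0_nbhs (R : realType)
    (m : {measure set (measurableTypeR R) -> \bar R})
    (D : set R) (h : R -> R) (x0 : R) :
  (forall a b : R, a < b -> (0 < m `]a, b[%classic)%E) ->
  measurable D -> nbhs x0 D -> continuous h -> (forall x, 0 <= h x) -> 0 < h x0 ->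
  (0 < \int[m]_(x in D) (h x)%:E)%E.
Proof.
move=> m0 mD D0 ch h0 hx0.
have hgt : \forall x \near x0, h x0 / 2 < h x.
  by apply: (cvgr_gt (h x0) (ch x0)); rewrite ltr_pdivrMr// ltr_pMr// ltr1n.
have : \forall x \near x0, D x /\ h x0 / 2 < h x by near=> x; split; near: x.
move=> /nbhs_ballP[d /= d0]; rewrite ball_itv => Bd.
set I : set R := `]x0 - d, x0 + d[%classic in Bd *.
have mI : measurable I.
  exact: measurable_itv.
have mh : measurable_fun setT h by exact: continuous_measurable_fun.
apply: (@lt_le_trans _ _ (\int[m]_(x in I) (h x)%:E)%E); last first.
  apply: ge0_subset_integral => //.
  - by apply/measurable_EFinP; exact: measurable_funTS.
  - by move=> x _; rewrite lee_fin.
  - by move=> x /Bd[].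
apply: (@lt_le_trans _ _ (\int[m]_(x in I) (h x0 / 2)%:E)%E); last first.
  apply: ge0_le_integral => //.
  - by move=> x _; rewrite lee_fin divr_ge0.
  - by apply/measurable_EFinP; exact: measurable_funTS.
  - by move=> x /Bd[_ /ltW]; rewrite lee_fin.
rewrite integral_cst// mule_gt0 ?lte_fin ?divr_gt0//.
by apply: m0; rewrite ltrBlDr -addrA ltrDl addr_gt0.
Unshelve. all: by end_near. Qed.

Lemma gauss_itv_gt0 (R : realType) (a b : R) : a < b ->
  (0 < gauss R `]a, b[%classic)%E.
Proof.
move=> ab.
apply: (@integral_gt0_nbhs _ lebesgue_measure _ (normal_pdf 0 1)
  ((a + b) / 2)) => //.
- move=> u v uv; have := @lebesgue_measure_itv R `]u, v[.
  by rewrite /= lte_fin uv -EFinB => ->; rewrite lte_fin subr_gt0.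
- have m_ab : (a + b) / 2 \in `]a, b[ by rewrite in_itv/= !midf_lt.
  exact: (near_in_itvoo m_ab).
- by apply: continuous_normal_pdf; rewrite oner_eq0.
- by move=> x; exact: normal_pdf_ge0.
- rewrite normal_pdfE ?oner_eq0// mulr_gt0 ?expR_gt0//.
  by rewrite normal_peak_gt0 ?oner_eq0.
Qed.

Lemma gauss_opp (R : realType) (A : set R) :
  measurable A -> gauss R (-%R @^-1` A) = gauss R A.
Proof.
move=> mA.
pose p (x : R) : \bar R := (normal_pdf 0 1 x)%:E.
have mp : measurable_fun setT p.
  by apply/measurable_EFinP; exact: measurable_normal_pdf.
pose opp : R -> measurableTypeR R := -%R.
have mopp : measurable_fun setT opp by exact: oppr_measurable.
transitivity (\int[lebesgue_measure]_(x in opp @^-1` A) (p \o opp) x)%E.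
  apply: eq_integral => x _; rewrite /p /opp /=; congr EFin.
  by rewrite !normal_pdfE ?oner_eq0// /normal_fun !subr0 sqrrN.
rewrite -ge0_integral_pushforward//.
- by apply: eq_measure_integral => B mB _; exact: lebesgue_measureN.
- exact: measurable_funTS.
- by move=> x _; rewrite lee_fin normal_pdf_ge0.
Qed.

Lemma bounded_Lfun2 (R : realType) (h : R -> R) : measurable_fun setT h ->
  (forall x, `|h x| <= 1) -> h \in Lfun (gauss R) 2%:E.
Proof.
move=> mh h1; rewrite inE/=; apply/andP; split; rewrite inE//=.
rewrite /finite_norm unlock poweR_lty//.
apply: (@le_lt_trans _ _ (\int[gauss R]_x (cst 1 x))%E).
  apply: ge0_le_integral => //.
  - by move=> x _; rewrite poweR_ge0.
  - apply: (@measurableT_comp _ _ _ _ _ _ (fun x => x `^ 2)%E) => //.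
      exact: measurable_poweR.
    by apply: measurableT_comp => //; apply/measurable_EFinP.
  - move=> x _; rewrite poweR_EFin lee_fin.
    by rewrite powR_mulrn// expr_le1.
by rewrite integral_cst// mul1e (le_lt_trans (probability_le1 _ _)) ?ltry.
Qed.

(** Local absolute continuity comes from the mean value theorem, which makes
    [h] Lipschitz with constant [1]. *)
Lemma W12_of_bounded_derivative (R : realType) (h dh : R -> R) :
  (forall x : R, is_derive x 1 h (dh x)) -> continuous dh ->
  (forall x, `|h x| <= 1) -> (forall x, `|dh x| <= 1) ->
  W12 (fun x => (h x)%:C).
Proof.
move=> hd cdh h1 dh1.
have ch : continuous h.
  move=> x; apply: differentiable_continuous.
  by apply/derivable1_diffP; case: (hd x).
have dE : derive1 h = dh by apply/funext => x; rewrite derive1E; case: (hd x).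
have lip (u v : R) : u <= v -> `|h v - h u| <= v - u.
  move=> uv.
  have [c _ ->] := MVT_segment uv (fun x _ => hd x) (continuous_subspaceT ch).
  by rewrite normrM [X in _ * X]ger0_norm ?subr_ge0// ler_piMl// subr_ge0.
split.
- move=> a b ab; split => eps eps0; exists eps => // n u v uv _; last first.
    by move=> _; rewrite big1// => i _; rewrite /= subrr normr0.
  apply: le_lt_trans; apply: ler_sum => i _ /=; apply: lip.
  by case: (uv i).
- split => /=.
    by apply: bounded_Lfun2 => //; exact: continuous_measurable_fun.
  exact: Lfun_cst.
- split => /=.
    rewrite [X in X \in _](_ : _ = dh); last exact: dE.
    by apply: bounded_Lfun2 => //; exact: continuous_measurable_fun.
  rewrite [X in X \in _](_ : _ = cst 0); first exact: Lfun_cst.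
  by apply/funext => x; rewrite derive1_cst.
Qed.

Lemma bounded_integrable (R : realType) (h : R -> R) : measurable_fun setT h ->
  (forall x, `|h x| <= 1) -> (gauss R).-integrable setT (EFin \o h).
Proof.
move=> mh h1; apply/Lfun1_integrable.
by apply: Lfun_subset12; [exact: fin_num_measure|exact: bounded_Lfun2].
Qed.

Lemma integral_gauss_odd (R : realType) (h : R -> R) : measurable_fun setT h ->
  (forall x, `|h x| <= 1) -> (forall x, h (- x) = - h x) ->
  \int[gauss R]_x h x = 0.
Proof.
move=> mh h1 hN.
have mEh : measurable_fun setT (EFin \o h) by exact/measurable_EFinP.
have ih := bounded_integrable mh h1.
pose opp : measurableTypeR R -> measurableTypeR R := -%R.
have mopp : measurable_fun setT opp by exact: oppr_measurable.
have iopp : (gauss R).-integrable (opp @^-1` setT) ((EFin \o h) \o opp).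
  rewrite preimage_setT (_ : _ \o opp = (fun x => - (EFin \o h) x)%E).
    exact: integrableN.
  by apply/funext => x /=; rewrite /opp hN.
have E : (\int[gauss R]_x (h x)%:E = \int[gauss R]_x (h (- x))%:E)%E.
  transitivity (\int[gauss R]_(x in opp @^-1` setT) ((EFin \o h) \o opp) x)%E.
    rewrite -(integral_pushforward mopp mEh iopp measurableT).
    by apply: eq_measure_integral => B mB _; exact/esym/gauss_opp.
  by rewrite preimage_setT.
have : \int[gauss R]_x h x = - \int[gauss R]_x h x.
  rewrite {1}/Rintegral E -mulN1r -RintegralZl//; congr fine.
  by apply: eq_integral => x _; rewrite hN mulN1r.
move: (Rintegral _ _ _) => t; lra.
Qed.

(** * The constant function is not an eigenfunction *)

Section odd_test.
Context {R : realType}.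

(** The exponent [2] makes both [odd_test] and its product with the weight
    [x ^+ 2] of the form bounded. *)
Definition odd_test (x : R) : R := x * ((1 + x ^+ 2)^-1) ^+ 2.

Let D_gt0 (x : R) : 0 < 1 + x ^+ 2.
Proof. by rewrite ltr_pwDl// sqr_ge0. Qed.

Let quotient_le1 (a x : R) n :
  `|a| <= (1 + x ^+ 2) ^+ n -> `|a * ((1 + x ^+ 2)^-1) ^+ n| <= 1.
Proof.
move=> aD; rewrite normrM [X in _ * X]ger0_norm; last first.
  by rewrite exprn_ge0// invr_ge0 ltW.
by rewrite exprVn ler_pdivrMr ?exprn_gt0// mul1r.
Qed.

Lemma odd_testN x : odd_test (- x) = - odd_test x.
Proof. by rewrite /odd_test sqrrN mulNr. Qed.

Lemma odd_test_le1 x : `|odd_test x| <= 1.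
Proof.
apply: quotient_le1; rewrite -(real_normK (num_real x)).
by move: (normr_ge0 x) => ?; nra.
Qed.

Lemma sqr_odd_test_le1 x : `|x ^+ 2 * odd_test x| <= 1.
Proof.
rewrite /odd_test mulrA; apply: quotient_le1.
rewrite normrM normrX -(real_normK (num_real x)).
move: (normr_ge0 x); move: `|x| => t t0.
(* A certificate for [t ^+ 3 <= (1 + t ^+ 2) ^+ 2]. *)
have : 0 <= t ^+ 2 * ((t - 1) ^+ 2 + 1) by rewrite mulr_ge0 ?addr_ge0 ?sqr_ge0.
nra.
Qed.

Let odd_test_der (x : R) : R := (1 - 3 * x ^+ 2) * ((1 + x ^+ 2)^-1) ^+ 3.

Let is_derive_D (x : R) : is_derive x 1 (fun y : R => 1 + y ^+ 2) (2 * x).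
Proof.
have : is_derive x 1 (cst (1 : R) + id ^+ 2) (0 + (2%:R * x ^+ 1) *: 1).
  exact: is_deriveD.
by rewrite add0r expr1 scaler1.
Qed.

Let continuous_DV : continuous (fun y : R => (1 + y ^+ 2)^-1).
Proof.
move=> x; apply: cvgV; first by rewrite gt_eqF.
have [/derivable1_diffP + _] := is_derive_D x.
exact: differentiable_continuous.
Qed.

Lemma is_derive_odd_test (x : R) : is_derive x 1 odd_test (odd_test_der x).
Proof.
have [dD eD] := is_derive_D x.
have D0 : 1 + x ^+ 2 != 0 by rewrite gt_eqF.
have dV : is_derive x 1 (fun y : R => (1 + y ^+ 2)^-1)
    (- (1 + x ^+ 2) ^- 2 * (2 * x)).
  apply: DeriveDef; first exact: derivableV.
  by rewrite deriveV// eD.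
rewrite (_ : odd_test = id * (fun y : R => (1 + y ^+ 2)^-1) ^+ 2)//.
apply: is_derive_eq; rewrite /odd_test_der /GRing.scale /= exprfctE.
by field.
Qed.

Lemma continuous_odd_test : continuous odd_test.
Proof.
move=> x; have [/derivable1_diffP + _] := is_derive_odd_test x.
exact: differentiable_continuous.
Qed.

Lemma W12_odd_test : W12 (fun x => (odd_test x)%:C).
Proof.
apply: (W12_of_bounded_derivative is_derive_odd_test).
- move=> x; apply: (@cvgM _ _ _ _ (fun y : R => 1 - 3 * y ^+ 2)
    (fun y : R => ((1 + y ^+ 2)^-1) ^+ 3)); last first.
    apply: (@continuous_comp _ _ _ (fun y : R => (1 + y ^+ 2)^-1)
      (fun y => y ^+ 3)).
      exact: continuous_DV.
    exact: exprn_continuous.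
  apply: (@cvgB _ R^o _ _ _ (cst 1) (fun y : R => 3 * y ^+ 2)).
    exact: cvg_cst.
  apply: (@cvgM _ _ _ _ (cst 3) (fun y : R => y ^+ 2)); first exact: cvg_cst.
  exact: sqr_continuous.
- exact: odd_test_le1.
- move=> x; apply: quotient_le1; rewrite ler_norml.
  have := sqr_ge0 x; move: (x ^+ 2) => t t0; apply/andP; split; nra.
Qed.

Lemma integral_sqr_odd_test_lt0 :
  \int[gauss R]_(x in `]-oo, 0]) (x ^+ 2 * odd_test x) < 0.
Proof.
set D : set R := [set` `]-oo, 0]].
have mD : measurable (D : set (measurableTypeR R)) by exact: measurable_itv.
pose h (x : R) := x ^+ 2 * `|odd_test x|.
have ch : continuous h.
  move=> x; apply: cvgM; first exact: sqr_continuous.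
  by apply: cvg_norm; exact: continuous_odd_test.
have mh : measurable_fun setT h by exact: continuous_measurable_fun.
have h0 x : 0 <= h x by rewrite mulr_ge0 ?sqr_ge0.
have hE x : x \in D -> x ^+ 2 * odd_test x = - h x.
  rewrite /D inE/= in_itv/= => x0; rewrite /h -mulrN; congr (_ * _).
  by rewrite ler0_norm ?opprK// mulr_le0_ge0// exprn_ge0// invr_ge0 ltW.
have h1 : (\int[gauss R]_(x in D) (h x)%:E <= 1)%E.
  apply: (@le_trans _ _ (\int[gauss R]_(x in D) (cst 1 x))%E).
    apply: ge0_le_integral => //.
    - by move=> x _; rewrite lee_fin.
    - by apply/measurable_EFinP; exact: measurable_funTS.
    - move=> x _; rewrite lee_fin (le_trans _ (sqr_odd_test_le1 x))//.
      by rewrite normrM [`|x ^+ 2|]ger0_norm ?sqr_ge0.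
  by rewrite integral_cst// mul1e probability_le1.
have hpos : (0 < \int[gauss R]_(x in D) (h x)%:E)%E.
  apply: (@integral_gt0_nbhs _ (gauss R) _ h (-1)) => //.
  - exact: gauss_itv_gt0.
  - have m1 : -1 \in `]-oo, (0 : R)[ by rewrite in_itv/= ltrN10.
    apply: filterS (near_in_itvNyo m1) => x; rewrite /D /=.
    by rewrite !in_itv/=; exact: ltW.
  - rewrite mulr_gt0 ?exprn_even_gt0 ?oppr_eq0 ?oner_eq0// normr_gt0.
    by rewrite mulf_neq0 ?oppr_eq0 ?oner_eq0// expf_neq0// invr_eq0 gt_eqF.
rewrite (_ : \int[gauss R]_(x in D) _ =
    \int[gauss R]_(x in D) (-1 * h x)); last first.
  by apply: eq_Rintegral => x /hE ->; rewrite mulN1r.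
rewrite RintegralZl//.
  rewrite mulN1r oppr_lt0 fine_gt0// hpos/=.
  by rewrite (le_lt_trans h1)// ltry.
apply/integrableP; split; first by apply/measurable_EFinP; exact: measurable_funTS.
under eq_integral do rewrite /= ger0_norm//.
by rewrite (le_lt_trans h1)// ltry.
Qed.

End odd_test.

Lemma Cintegral_real d (T : measurableType d) (R : realType)
    (P : {measure set T -> \bar R}) (D : set T) (f : T -> R) :
  Cintegral P D (fun x => (f x)%:C) = (\int[P]_(x in D) f x)%:C.
Proof.
rewrite /Cintegral /=; congr (_ +i* _).
by rewrite /Rintegral integral0.
Qed.

Lemma cmu_gt0 (R : realType) (mu : R) : 0 < mu < 1 -> 0 < cmu mu.
Proof.
move=> /andP[mu0 mu1]; rewrite /cmu divr_gt0 ?mulr_gt0 ?exprn_gt0//.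
by rewrite subr_gt0 expr_lt1// ltW.
Qed.

(** Tested against [odd_test], the weak equation for the function [1] has a
    vanishing gradient term and a vanishing right-hand side, but a negative
    potential term. *)
Lemma one_not_eigenfunction (R : realType) (mu alpha : R) : 0 < mu < 1 ->
  ~ opA mu (fun=> 1%:C) (fun=> alpha%:C * 1%:C).
Proof.
move=> /cmu_gt0 c0 [_ _ /(_ _ W12_odd_test)].
rewrite /energy_form /L2inner.
have conjR (a : R) : (a%:C)^* = a%:C by exact: conjc_real.
rewrite [X in Cintegral _ _ X + _](_ : _ = fun=> 0%:C); last first.
  apply/funext => x; rewrite {1}/Cderive /= !derive1_cst.
  exact: mul0r.
rewrite [X in _ * Cintegral _ _ X](_ : _ =
    fun x => (x ^+ 2 * odd_test x)%:C); last first.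
  by apply/funext => x; rewrite mulr1 conjR -rmorphM.
rewrite [X in _ = Cintegral _ _ X](_ : _ =
    fun x => (alpha * odd_test x)%:C); last first.
  by apply/funext => x; rewrite mulr1 conjR -rmorphM.
rewrite !Cintegral_real -rmorphM -rmorphD => /(congr1 (@complex.Re R)) /=.
have modd : measurable_fun setT (@odd_test R).
  by apply: continuous_measurable_fun; exact: continuous_odd_test.
rewrite RintegralZl//; last first.
  exact: bounded_integrable modd (@odd_test_le1 R).
rewrite (integral_gauss_odd modd (@odd_test_le1 R) (@odd_testN R)).
rewrite mulr0 [X in X + _](_ : _ = 0); last by rewrite /Rintegral integral0.
move=> /eqP; rewrite add0r mulf_eq0 gt_eqF//=.
by rewrite lt_eqF// integral_sqr_odd_test_lt0.
Qed.

(** * The affinity of the ground state with the Gaussian measure *)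

Section ground_state.
Context {R : realType}.
Variables (mu : R) (e : R -> R).
Hypotheses (mu01 : 0 < mu < 1) (gs : is_ground_state mu e).

Lemma ground_state_continuous : continuous e.
Proof.
case: gs => _ [de _] _ _ x.
by apply: differentiable_continuous; apply/derivable1_diffP.
Qed.

Lemma ground_state_sqr : (\int[gauss R]_y (e y ^+ 2)%:E = 1)%E.
Proof.
case: gs => e0 _ eN _.
transitivity ('N[gauss R]_2%:E[EFin \o e] `^ 2)%E; last first.
  by rewrite eN -[1%E]/(1%:E) poweR_EFin powR1.
rewrite poweR_Lnorm//; apply: eq_integral => y _.
by rewrite /= gtr0_norm// powR_mulrn// ltW.
Qed.

Lemma ground_state_nonconstant : exists x, e x != 1.
Proof.
apply: contrapT => /forallNP e1.
have eE : e = fun=> 1.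
  by apply/funext => x; have /negP := e1 x; rewrite negbK => /eqP.
by case: gs => _ _ _ [alpha [_ [_]]]; rewrite eE; exact: one_not_eigenfunction.
Qed.

(** The integral of [(e - 1)^2 + 2 e = e^2 + 1] is [2], so the mean of [e] is
    finite, and it is below [1] because [(e - 1)^2] has positive integral. *)
Lemma ground_state_mean_lt1 :
  exists2 r : R, (\int[gauss R]_y (e y)%:E = r%:E)%E & r < 1.
Proof.
have e0 : forall x, 0 < e x by case: gs.
have ce := ground_state_continuous.
have me : measurable_fun setT e by exact: continuous_measurable_fun.
have cJ : continuous (fun y => (e y - 1) ^+ 2).
  move=> y; apply: (@continuous_comp _ _ _ (fun y => e y - 1) (fun y => y ^+ 2)).
    by apply: (@cvgB _ R^o _ _ _ e (cst 1)); [exact: ce|exact: cvg_cst].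
  exact: exprn_continuous.
have mJ : measurable_fun setT (fun y => (e y - 1) ^+ 2).
  exact: continuous_measurable_fun.
have : (0 < \int[gauss R]_y ((e y - 1) ^+ 2)%:E)%E.
  have [x ex] := ground_state_nonconstant.
  apply: (@integral_gt0_nbhs _ (gauss R) setT _ x) => //.
  - exact: gauss_itv_gt0.
  - exact: filterT.
  - by move=> y; exact: sqr_ge0.
  - by rewrite exprn_even_gt0//= subr_eq0.
have : (\int[gauss R]_y ((e y - 1) ^+ 2)%:E +
    2%:E * \int[gauss R]_y (e y)%:E = 2%:E)%E.
  rewrite -ge0_integralZl//.
  - rewrite -ge0_integralD//.
    + transitivity (\int[gauss R]_y ((e y ^+ 2)%:E + cst 1 y))%E.
        apply: eq_integral => y _; rewrite -EFinM -!EFinD.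
        by congr EFin; ring.
      rewrite ge0_integralD//.
      * rewrite ground_state_sqr integral_cst// mul1e.
        transitivity (1 + 1 : \bar R)%E => //; congr (_ + _)%E.
        exact: probability_setT.
      * by move=> y _; rewrite lee_fin sqr_ge0.
      * by apply/measurable_EFinP; exact: measurable_funX.
    + by move=> y _; rewrite lee_fin sqr_ge0.
    + exact/measurable_EFinP.
    + by move=> y _; rewrite mule_ge0// lee_fin ltW.
    + by apply: measurable_funeM; exact/measurable_EFinP.
  - exact/measurable_EFinP.
  - by move=> y _; rewrite lee_fin ltW.
have : (0 <= \int[gauss R]_y (e y)%:E)%E.
  by apply: integral_ge0 => y _; rewrite lee_fin ltW.
case: (\int[gauss R]_y (e y)%:E)%E => [r| |] //; last first.
  by rewrite gt0_muley ?lte_fin//; case: (integral _ _ _).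
case: (integral _ _ _) => [J| |] //= _.
rewrite -EFinM -EFinD lte_fin => -[JE] J0; exists r => //; lra.
Qed.

End ground_state.

Unset Implicit Arguments.

Theorem proposition3p5 (R : realType) (mu : R) (e0 : R -> R)
    (numuN gammaN : probability (RN R) R) :
  0 < mu < 1 ->
  is_ground_state mu e0 ->
  is_countable_power (ground_measure e0) numuN ->
  is_countable_power (gauss R) gammaN ->
  mutually_singular numuN gammaN /\
  ~ (exists F : RN R -> R[i], inL2 gammaN F /\
       L2cvg gammaN (fun m x => (\prod_(j < m) e0 (x j))%:C) F).
Proof.
move=> mu01 gs nuP gammaP.
have [r er r1] := ground_state_mean_lt1 mu01 gs.
have e_gt0 : forall y, 0 < e0 y by case: gs.
have ce := ground_state_continuous gs.
have e1 := ground_state_sqr gs.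
split; first exact: likelihood_singular ce e_gt0 er r1 nuP gammaP.
move=> [F [F2 ZF]].
exact: (likelihood_not_L2cvg ce e_gt0 e1 er r1 gammaP F2 ZF).
Qed.
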